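(* The conditioned two-dimensional walk $\widehat S$ has the Liouville property: every bounded function $h:\mathbb{Z}^2\setminus\{0\}\to\mathbb{R}$ that is harmonic with respect to $\widehat S$, i.e. satisfies $h(x)=\sum_{y}\widehat P_{xy}h(y)$ for all $x\in\mathbb{Z}^2\setminus\{0\}$ (sum over $y\in\mathbb{Z}^2\setminus\{0\}$), is constant.
   Context: For $x,y\in\mathbb{Z}^2$ write $x\sim y$ if $x$ and $y$ are nearest neighbours in $\mathbb{Z}^2$. Let $(S_k)_{k\ge0}$ be the simple random walk on $\mathbb{Z}^2$ (transition probability $1/4$ to each neighbour). Its potential kernel is $$a(x)=\sum_{k=0}^\infty\big(\mathbb{P}_0[S_k=0]-\mathbb{P}_x[S_k=0]\big),\qquad x\in\mathbb{Z}^2,$$ where $\mathbb{P}_x$ is the law of the walk started at $x$; the series converges, $a(0)=0$, $a(x)>0$ for $x\ne0$, $a(x)=1$ for $x\sim 0$, and $\frac14\sum_{y\sim x}a(y)=a(x)$ for all $x\neq 0$. The conditioned walk $(\widehat S_k)_{k\ge 0}$ is the Markov chain on $\mathbb{Z}^2\setminus\{0\}$ with transition probabilities $\widehat P_{xy}=\frac{a(y)}{4a(x)}$ if $x\sim y$ (and $x\ne 0$), and $\widehat P_{xy}=0$ otherwise. A Markov chain has the Liouville property if all bounded functions that are harmonic with respect to it are constant. *)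

(* Defs.v *)
From mathcomp Require Import all_boot all_order all_algebra.
From mathcomp Require Import all_classical all_reals all_analysis.

Set Implicit Arguments.
Unset Strict Implicit.
Unset Printing Implicit Defensive.

Import Order.TTheory GRing.Theory Num.Theory.
Import numFieldNormedType.Exports.

Local Open Scope classical_set_scope.
Local Open Scope ring_scope.

(* Markov chains on a countable state space T with transition probabilities
   P : T -> T -> R.  The sums below are finitely supported sums
   (\sum_(i \in A) is 0 by convention when the support is infinite), so these
   notions are meant for chains of finite range: {y | P x y != 0} is finite
   for every x. *)
Section MarkovChain.
Context {R : realType} {T : countType}.
Implicit Types (P : T -> T -> R) (x y z : T).

(* P_x[S_1 = x_1, ..., S_k = x_k] for s = [:: x_1; ...; x_k] *)
Fixpoint path_prob P x (s : seq T) : R :=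
  if s is y :: s' then P x y * path_prob P y s' else 1.

(* P_x[S_k = z] *)
Definition law P x (k : nat) z : R :=
  \sum_(s \in [set s : seq T | size s = k /\ last x s = z]) path_prob P x s.

Definition harmonic_for P (h : T -> R) : Prop :=
  forall x, h x = \sum_(y \in [set: T]) P x y * h y.

Definition Liouville_property P : Prop :=
  forall h : T -> R, bounded_fun h -> harmonic_for P h ->
    exists c : R, forall x, h x = c.

End MarkovChain.

Notation Z2 := (int * int)%type.

Definition nearest_neighbour (x y : Z2) : bool :=
  `|x.1 - y.1| + `|x.2 - y.2| == 1.

Definition srw (R : realType) (x y : Z2) : R :=
  if nearest_neighbour x y then 4^-1 else 0.

Definition potential_kernel (R : realType) (x : Z2) : R :=
  limn (series (fun k : nat => law (@srw R) 0 k 0 - law (@srw R) x k 0)).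

Notation Z2_punctured := {x : Z2 | x != 0}.

Definition conditioned_srw (R : realType) (x y : Z2_punctured) : R :=
  if nearest_neighbour (val x) (val y)
  then potential_kernel R (val y) / (4 * potential_kernel R (val x))
  else 0.

(* Main.v *)
Require Import Defs.
From mathcomp Require Import all_boot all_order all_algebra.
From mathcomp Require Import all_classical all_reals all_analysis.
From mathcomp Require Import ring lra zify.

Set Implicit Arguments.
Unset Strict Implicit.
Unset Printing Implicit Defensive.

Import Order.TTheory GRing.Theory Num.Theory.
Import numFieldNormedType.Exports.

Local Open Scope classical_set_scope.
Local Open Scope ring_scope.

(** Write [P] for the averaging operator over the four neighbours and [a] for
the potential kernel. If [h] is bounded and harmonic for the conditioned walk,
then [g = a h], extended by [g 0 = 0], satisfies [P g = g] off the origin. As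
[P a = a + 1_0], subtracting [b a] with [b = P g 0] repairs the defect at the
origin: [u = g - b a] is harmonic on the whole of [Z^2], and [|u| <= C a]. It
remains to see that [u = 0]; then [h = b], since [a > 0] off the origin.

Harmonic functions of sublinear growth on [Z^2] are constant. Indeed the energy
density [G = P (u^2) - u^2] is subharmonic, being an average of squares of the
harmonic functions [u (x + e) - u x]; hence along the walk
[E_x u(S_n)^2 >= u(x)^2 + n G x], whereas [u^2 <= al + be |x|^2] gives
[E_x u(S_n)^2 <= al + be (|x|^2 + n)]. Thus [G <= be] ([energy_le]), and [be]
can be taken arbitrarily small when [u^2 = o(|x|^2)].

So all that is required of [a] is convergence, positivity, [P a = a + 1_0] and
[a^2 = o(|x|^2)]. In the coordinates [x1 + x2] and [x1 - x2] the planar walk is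
a pair of independent walks on [Z], so the probability of being at the origin
is a product of two one-dimensional ones ([prob0_walk1]). These satisfy the
closed recurrence [walk1_ratio] in the starting point, from which one gets
[0 <= P_0(S_n = 0) - P_x(S_n = 0) <= min (1/(n+1), |x|^2/(n+1)^2)] for [x] in
the even sublattice ([prob0_even]). Summing, [a] is at most one plus the
harmonic sum up to [|x|^2] there, which is far more than needed. Sites of the
odd sublattice are reached by averaging over their neighbours, all even. *)

(** * Chains of finite range *)

Section FiniteRange.
Context {R : realType} {T : countType} (P : T -> T -> R) (N : T -> seq T).
Context (uniqN : forall x, uniq (N x)).
Context (PN : forall x y, y \notin N x -> P x y = 0).

(** The paths that the chain can follow; enumerating them turns the finitely
supported sums over all sequences into sums over lists. *)
Fixpoint paths (k : nat) (x : T) : seq (seq T) :=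
  if k is k'.+1 then [seq y :: s | y <- N x, s <- paths k' y] else [:: [::]].

Lemma paths_uniq k x : uniq (paths k x).
Proof.
elim: k x => [//|k IH] x /=.
apply: allpairs_uniq_dep => [//|y _|]; first exact: IH.
by move=> [y s] [y' s'] _ _ /= [-> ->].
Qed.

Lemma size_paths k x s : s \in paths k x -> size s = k.
Proof.
elim: k x s => [|k IH] x s /=; first by rewrite inE => /eqP ->.
by case/allpairsPdep => y [s' [_ /IH <- ->]].
Qed.

Lemma path_prob_notin k x s :
  size s = k -> s \notin paths k x -> path_prob P x s = 0.
Proof.
elim: k x s => [|k IH] x [|y s] //= [ss] Ns.
have [yN|/PN ->] := boolP (y \in N x); last by rewrite mul0r.
rewrite (IH y s ss) ?mulr0//; apply: contra Ns => sp.
by apply/allpairsPdep; exists y, s.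
Qed.

Lemma lawE k x z :
  law P x k z = \sum_(s <- paths k x | last x s == z) path_prob P x s.
Proof.
transitivity (\sum_(s \in [set` [pred s | (size s == k) && (last x s == z)]])
                path_prob P x s).
  apply: eq_fsbigl; apply/seteqP; split=> s /=; rewrite inE /=.
    by case=> -> ->; rewrite !eqxx.
  by case/andP=> /eqP -> /eqP ->.
rewrite -(@bigfs _ _ _ _ (paths k x)) ?paths_uniq//=; last first.
  by move=> s /= /andP[/eqP ss _]; exact: path_prob_notin.
rewrite big_seq_cond [RHS]big_seq_cond; apply: eq_bigl => s /=.
by case: (boolP (s \in _)) => //= /size_paths ->; rewrite eqxx.
Qed.

Lemma law0 x z : law P x 0 z = (x == z)%:R.
Proof. by rewrite lawE /= big_mkcond big_seq1/=; case: eqP. Qed.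

(** The Markov property at time one. *)
Lemma lawS k x z :
  law P x k.+1 z = \sum_(y <- N x) P x y * law P y k z.
Proof.
rewrite lawE big_mkcond big_allpairs_dep; apply: eq_bigr => y _ /=.
by rewrite -big_mkcond -big_distrr/= -lawE.
Qed.

Lemma fsum_finite_range x (h : T -> R) :
  \sum_(y \in [set: T]) P x y * h y = \sum_(y <- N x) P x y * h y.
Proof.
rewrite (fsbigE (N x))//; first by apply: eq_bigl => y; rewrite in_setT.
by move=> y _ /PN ->; rewrite mul0r.
Qed.

End FiniteRange.

Section PlanarWalk.
Context (R : realType).
Implicit Types (x y : Z2) (f : Z2 -> R) (n : nat) (m i : int).

(** * The averaging operator of the planar walk *)

Definition neighbours x : seq Z2 :=
  [:: (x.1 + 1, x.2); (x.1 - 1, x.2); (x.1, x.2 + 1); (x.1, x.2 - 1)].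

Definition avg f x : R :=
  4^-1 * (f (x.1 + 1, x.2) + f (x.1 - 1, x.2) + f (x.1, x.2 + 1)
          + f (x.1, x.2 - 1)).

Lemma neighbours_uniq x : uniq (neighbours x).
Proof. by case: x => a b; rewrite /= !inE !xpair_eqE; lia. Qed.

Lemma mem_neighbours x y : (y \in neighbours x) = nearest_neighbour x y.
Proof.
case: x y => [a b] [c d].
by rewrite /nearest_neighbour /neighbours !inE !xpair_eqE/=; lia.
Qed.

Lemma sum_neighbours f x : \sum_(y <- neighbours x) f y = 4 * avg f x.
Proof.
rewrite /neighbours !big_cons big_nil /avg addr0 mulrA divff ?mul1r//.
by rewrite !addrA.
Qed.

Definition prob0 n x : R := law (@srw R) x n 0.

Lemma prob0_0 x : prob0 0 x = (x == 0)%:R.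
Proof.
by apply: (law0 neighbours_uniq) => a b; rewrite mem_neighbours /srw => /negbTE ->.
Qed.

Lemma prob0S n x : prob0 n.+1 x = avg (prob0 n) x.
Proof.
rewrite /prob0 (lawS neighbours_uniq); last first.
  by move=> a b; rewrite mem_neighbours /srw => /negbTE ->.
transitivity (\sum_(y <- neighbours x) 4^-1 * prob0 n y).
  apply: eq_big_seq => y; rewrite mem_neighbours /srw => ->//.
by rewrite -big_distrr /= sum_neighbours mulKf.
Qed.

(** * The one-dimensional walk *)

(** The probability that the simple random walk on the integers started at [m]
is at the origin at time [n]. *)
Fixpoint walk1 n m : R :=
  if n is n'.+1 then 2^-1 * (walk1 n' (m + 1) + walk1 n' (m - 1))
  else (m == 0)%:R.

(** The maps [x1 + x2] and [x1 - x2] send the four planar steps to the four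
sign patterns of a pair of independent one-dimensional steps. *)
Lemma prob0_walk1 n x : prob0 n x = walk1 n (x.1 + x.2) * walk1 n (x.1 - x.2).
Proof.
elim: n x => [|n IH] [a b].
  by rewrite prob0_0 /= -natrM mulnb xpair_eqE; congr (_%:R); lia.
rewrite prob0S /avg !IH /=.
have -> : a + 1 + b = a + b + 1 by ring.
have -> : a + 1 - b = a - b + 1 by ring.
have -> : a - 1 + b = a + b - 1 by ring.
have -> : a - 1 - b = a - b - 1 by ring.
have -> : a + (b + 1) = a + b + 1 by ring.
have -> : a - (b + 1) = a - b - 1 by ring.
have -> : a + (b - 1) = a + b - 1 by ring.
have -> : a - (b - 1) = a - b + 1 by ring.
by field.
Qed.

Lemma walk1_ge0 n m : 0 <= walk1 n m.
Proof.
by elim: n m => [|n IH] m /=; rewrite ?ler0n// mulr_ge0// addr_ge0.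
Qed.

Lemma walk1N n m : walk1 n (- m) = walk1 n m.
Proof.
elim: n m => [|n IH] m /=; first by rewrite oppr_eq0.
rewrite -(IH (m + 1)) -(IH (m - 1)) addrC.
by congr (_ * (walk1 n _ + walk1 n _)); ring.
Qed.

(** This is the ratio of consecutive binomial coefficients. It also holds at
starting points of the wrong parity or out of range, where it spares all case
distinctions; the induction combines the instances at [m + 1] and [m - 1]. *)
Lemma walk1_ratio n m :
  (n%:R + m%:~R + 2) * walk1 n (m + 2) = (n%:R - m%:~R) * walk1 n m.
Proof.
elim: n m => [|n IH] m /=.
  have [->|m0] := eqVneq m 0; first by rewrite !rmorph0; ring.
  have [->|m2] := eqVneq m (-2); first by rewrite rmorphN/= mulr0; ring.
  have /negbTE -> : m + 2 != 0 by lia.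
  by rewrite !mulr0.
have h1 := IH (m + 1); have h2 := IH (m - 1); move: h1 h2.
have -> : m - 1 + 2 = m + 1 by ring.
have -> : m + 1 + 2 = m + 2 + 1 by ring.
have -> : m + 2 - 1 = m + 1 by ring.
rewrite !(rmorphD, rmorphB, rmorph1) /= -(natr1 n).
set w := walk1 n (m + 1); set v := walk1 n (m - 1); set t := walk1 n (m + 2 + 1).
move=> h1 h2.
lra.
Qed.

Lemma walk1_even_noninc n (j : nat) :
  walk1 n (j.+1%:Z + j.+1%:Z) <= walk1 n (j%:Z + j%:Z).
Proof.
have := walk1_ratio n (j%:Z + j%:Z).
have -> : j%:Z + j%:Z + 2 = j.+1%:Z + j.+1%:Z by lia.
rewrite rmorphD/= => h.
have n0 : 0 <= n%:R :> R by []. have j0 : 0 <= j%:R :> R by [].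
have b0 := walk1_ge0 n (j%:Z + j%:Z).
move: h; rewrite -!pmulrn => h.
have d0 : 0 < n%:R + (j%:R + j%:R) + 2 :> R by lra.
by rewrite -(ler_pM2l d0) h ler_wpM2r//; lra.
Qed.

Lemma walk1_even_abs n i :
  walk1 n (i + i) = walk1 n (`|i|%N%:Z + `|i|%N%:Z).
Proof.
by case: (lerP 0 i) => i0; last rewrite -[LHS]walk1N; congr walk1; lia.
Qed.

Lemma walk1_even_le n i : walk1 n (i + i) <= walk1 n 0.
Proof.
rewrite walk1_even_abs.
elim: `|i|%N => [|j IH]; first by rewrite addr0.
exact: le_trans (walk1_even_noninc _ _) IH.
Qed.

(** By [walk1_ratio] the step from [2 j] to [2 j + 2] loses at most the
proportion [(4 j + 2) / (n + 2)] of [walk1 n 0], and the sum of [4 j + 2] for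
[j < i] is [2 i ^ 2]. *)
Lemma walk1_even_ge n i :
  (n%:R + 2) * (walk1 n 0 - walk1 n (i + i)) <= 2 * i%:~R ^+ 2 * walk1 n 0.
Proof.
rewrite walk1_even_abs.
have -> : i%:~R ^+ 2 = (`|i|%N)%:R ^+ 2 :> R.
  by rewrite natr_absz intr_norm real_normK ?num_real.
elim: `|i|%N => [|j IH].
  by rewrite addr0 subrr mulr0 expr0n mulr0 mul0r.
have := walk1_ratio n (j%:Z + j%:Z).
have -> : j%:Z + j%:Z + 2 = j.+1%:Z + j.+1%:Z by lia.
rewrite rmorphD/= => h.
have n0 : 0 <= n%:R :> R by []. have j0 : 0 <= j%:R :> R by [].
have h1 := walk1_even_le n j; have h2 := walk1_even_noninc n j.
move: h IH; rewrite -!pmulrn -(natr1 j).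
set a := walk1 n 0 in h1 *; set b := walk1 n (j%:Z + j%:Z) in h1 h2 *.
set c := walk1 n _ in h2 * => h IH.
have h3 : 0 <= j%:R * (b - c) by rewrite mulr_ge0// subr_ge0.
have h4 : 0 <= j%:R * (a - b) by rewrite mulr_ge0// subr_ge0.
lra.
Qed.

Lemma walk1_0SS n : (n%:R + 2) * walk1 n.+2 0 = (n%:R + 1) * walk1 n 0.
Proof.
have := walk1_ratio n 0; rewrite add0r addr0 subr0 => h.
have hN : walk1 n (- 1 - 1) = walk1 n 2 by rewrite -walk1N.
by rewrite /= !add0r subrr addNr hN -[(1 + 1)%R]/(2 : int); lra.
Qed.

(** Through [walk1_0SS] this reduces to [(n + 1) (n + 3) <= (n + 2) ^ 2]. *)
Lemma walk1_0_sqr n : walk1 n 0 ^+ 2 <= n.+1%:R^-1.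
Proof.
(* [walk1_0SS] moves by two time steps, so two consecutive times are carried. *)
have: walk1 n 0 ^+ 2 <= n.+1%:R^-1 /\ walk1 n.+1 0 ^+ 2 <= n.+2%:R^-1.
  elim: n => [|n [IH1 IH2]].
    have -> : walk1 1 0 = 0 by rewrite /= addr0 mulr0.
    by rewrite /= expr1n invr1 expr0n invr_ge0.
  split=> //; have := walk1_0SS n; move: IH1.
  move: (walk1 n 0) (walk1 n.+2 0) => a b.
  rewrite -[n.+3]addn3 -[n.+1]addn1 !natrD mulr1n => ha hb.
  have n0 : 0 <= n%:R :> R by [].
  have {}ha : (n%:R + 1) * a ^+ 2 <= 1 by rewrite mulrC -ler_pdivlMr ?div1r//; lra.
  have -> : b = (n%:R + 1) * a / (n%:R + 2) by rewrite -hb mulrC mulKf//; lra.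
  rewrite -[X in _ <= X]mul1r ler_pdivlMr; last lra.
  rewrite expr_div_n mulrAC ler_pdivrMr; last by rewrite exprn_gt0//; lra.
  have : 0 <= (1 - (n%:R + 1) * a ^+ 2) * ((n%:R + 1) * (n%:R + 3)).
    by rewrite mulr_ge0 ?mulr_ge0 ?subr_ge0//; lra.
  lra.
by case.
Qed.

End PlanarWalk.

(** * Probabilities of being at the origin *)

Section Kernel.
Context (R : realType).
Implicit Types (x y : Z2) (f g : Z2 -> R) (n : nat).

Lemma avg_le f g x :
  {in neighbours x, forall y, f y <= g y} -> avg f x <= avg g x.
Proof.
move=> fg; rewrite /avg ler_pM2l ?invr_gt0//.
by rewrite !lerD// fg// !inE eqxx ?orbT.
Qed.

Lemma avg_cst (c : R) x : avg (fun=> c) x = c.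
Proof. by rewrite /avg; field. Qed.

Lemma cvg_avg (F : nat -> Z2 -> R) f x :
  {in neighbours x, forall y, F n y @[n --> \oo] --> f y} ->
  avg (F n) x @[n --> \oo] --> avg f x.
Proof.
move=> Ff; rewrite /avg; apply: cvgM; first exact: cvg_cst.
by rewrite /=; do 3?[apply: cvgD]; apply: Ff; rewrite !inE eqxx ?orbT.
Qed.

Definition even_site x := (2 %| x.1 + x.2)%Z.

Lemma even_neighbours x y :
  y \in neighbours x -> even_site y = ~~ even_site x.
Proof.
case: x y => [a b] [c d]; rewrite /even_site !inE !xpair_eqE/=; lia.
Qed.

Definition normsq x : int := x.1 ^+ 2 + x.2 ^+ 2.

Lemma avg_normsq x :
  avg (fun y => (normsq y)%:~R) x = (normsq x)%:~R + 1 :> R.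
Proof.
by case: x => a b; rewrite /avg /normsq/= !(rmorphD, rmorphB, rmorphXn, rmorph1)/=; field.
Qed.

Lemma normsq_ge0 x : 0 <= normsq x.
Proof. by rewrite /normsq addr_ge0// sqr_ge0. Qed.

Notation prob0 := (@prob0 R).

Lemma prob0_ge0 n x : 0 <= prob0 n x.
Proof. by rewrite prob0_walk1 mulr_ge0// walk1_ge0. Qed.

Lemma even_siteP x : even_site x -> exists i j : int, x = (i + j, i - j).
Proof.
case: x => a b; rewrite /even_site /= => e.
exists ((a + b) %/ 2)%Z, (a - ((a + b) %/ 2)%Z).
by congr pair; lia.
Qed.

Lemma prob0_origin n : prob0 n 0 = walk1 R n 0 ^+ 2.
Proof. by rewrite prob0_walk1 expr2. Qed.

(** The last bound is the one that makes the kernel converge and grow slowly.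
With [c = walk1 n 0] and the factors [p, q <= c] of [prob0 n x], it comes from
[c^2 - p q <= c (c - p) + c (c - q)] and [walk1_even_ge]; the inequality is
restricted to even sites because at odd ones, by parity, at least one of the
two probabilities vanishes at each time, so their difference is of order
[1 / n] and the partial sums converge only through cancellation. *)
Lemma prob0_even n x : even_site x ->
  [/\ prob0 n x <= prob0 n 0, prob0 n 0 <= n.+1%:R^-1
    & prob0 n 0 - prob0 n x <= (normsq x)%:~R / n.+1%:R ^+ 2].
Proof.
case/even_siteP => i [j ->]; rewrite prob0_origin prob0_walk1 /=.
have -> : i + j + (i - j) = i + i by ring.
have -> : i + j - (i - j) = j + j by ring.
have -> : (normsq (i + j, i - j))%:~R = 2 * (i%:~R ^+ 2 + j%:~R ^+ 2) :> R.
  by rewrite /normsq/= rmorphD !rmorphXn/= rmorphB rmorphD; ring.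
have := walk1_even_le R n i; have := walk1_even_le R n j.
have := walk1_even_ge R n i; have := walk1_even_ge R n j.
have := walk1_ge0 R n (i + i); have := walk1_ge0 R n (j + j).
have := walk1_0_sqr R n; have := walk1_ge0 R n 0.
move: (walk1 R n (i + i)) (walk1 R n (j + j)) (walk1 R n 0) => p q c.
move: (i%:~R : R) (j%:~R : R) => s t c0 hc q0 p0 hq hp qc pc.
have n0 : 0 <= n%:R :> R by [].
split=> //; first by rewrite expr2 ler_pM.
have h1 : 0 <= c * (2 * t ^+ 2 * c - (n%:R + 2) * (c - q)).
  by rewrite mulr_ge0// subr_ge0.
have h2 : 0 <= c * (2 * s ^+ 2 * c - (n%:R + 2) * (c - p)).
  by rewrite mulr_ge0// subr_ge0.
have h3 : 0 <= (c - q) * ((n%:R + 2) * (c - p)).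
  by rewrite mulr_ge0 ?mulr_ge0 ?subr_ge0//; lra.
have h4 : (n%:R + 2) * (c ^+ 2 - p * q) <= 2 * (s ^+ 2 + t ^+ 2) * c ^+ 2.
  lra.
have h5 : 0 <= c ^+ 2 - p * q by rewrite subr_ge0 expr2 ler_pM.
rewrite -[n.+1%:R]natr1 in hc *.
rewrite ler_pdivlMr; last by rewrite exprn_gt0//; lra.
have {}hc : (n%:R + 1) * c ^+ 2 <= 1 by rewrite mulrC -ler_pdivlMr ?div1r//; lra.
have h6 : 0 <= (s ^+ 2 + t ^+ 2) * (1 - (n%:R + 1) * c ^+ 2).
  by rewrite mulr_ge0 ?subr_ge0// addr_ge0// sqr_ge0.
have h7 : 0 <= (n%:R + 1) * (2 * (s ^+ 2 + t ^+ 2) * c ^+ 2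
   - (n%:R + 2) * (c ^+ 2 - p * q)) by rewrite mulr_ge0 ?subr_ge0//; lra.
have h8 : 0 <= (n%:R + 1) * (c ^+ 2 - p * q) by rewrite mulr_ge0//; lra.
lra.
Qed.

Lemma prob0S_le n x : prob0 n.+1 x <= n.+1%:R^-1.
Proof.
have [ex|ox] := boolP (even_site x).
  have [h1 h2 _] := prob0_even n.+1 ex.
  by rewrite (le_trans h1)// (le_trans h2)// lef_pV2 ?posrE// ler_nat.
rewrite prob0S -[leRHS](avg_cst _ x); apply: avg_le => y /even_neighbours.
by rewrite ox => /(prob0_even n)[h1 h2 _]; exact: le_trans h2.
Qed.

Lemma prob0_cvg0 x : prob0 n x @[n --> \oo] --> (0 : R).
Proof.
rewrite -cvg_shiftS; apply: (@squeeze_cvgr _ _ _ _ (cst 0) harmonic).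
- by near=> n; rewrite prob0_ge0 prob0S_le.
- exact: cvg_cst.
- exact: cvg_harmonic.
Unshelve. all: by end_near. Qed.

(** * The potential kernel *)

Definition partial_kernel n x : R := series (fun k => prob0 k 0 - prob0 k x) n.

Lemma partial_kernel0 x : partial_kernel 0 x = 0.
Proof. by rewrite /partial_kernel /series/= big_nil. Qed.

Lemma partial_kernelS n x :
  partial_kernel n.+1 x = partial_kernel n x + (prob0 n 0 - prob0 n x).
Proof. by rewrite /partial_kernel /series/= big_nat_recr. Qed.

(** Averaging shifts [prob0] by one time step, so the sum telescopes. *)
Lemma avg_partial_kernel n x :
  avg (partial_kernel n) x = partial_kernel n x + (x == 0)%:R - prob0 n x.
Proof.
elim: n => [|n IH].
  by rewrite prob0_0 /avg !partial_kernel0 !addr0 mulr0 add0r subrr.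
transitivity (avg (partial_kernel n) x + prob0 n 0 - avg (prob0 n) x).
  by rewrite /avg !partial_kernelS; field.
by rewrite IH -prob0S partial_kernelS; ring.
Qed.

Lemma partial_kernel_even_nd x : even_site x -> nondecreasing_seq (partial_kernel ^~ x).
Proof.
move=> ex; apply/nondecreasing_seqP => n; rewrite partial_kernelS lerDl subr_ge0.
by have [] := prob0_even n ex.
Qed.

(** Terms of index below [|x|^2] are bounded by [1/(k+1)], the others by
[|x|^2/(k+1)^2]; the tail of the latter telescopes to at most one. *)
Lemma partial_kernel_even_le n x : even_site x ->
  partial_kernel n x <= series harmonic `|normsq x|%N + 1.
Proof.
move=> ex; set N := `|normsq x|%N.
have NE : (normsq x)%:~R = N%:R :> R.
  by rewrite natr_absz ger0_norm// normsq_ge0.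
have small m : partial_kernel m x <= series harmonic m.
  elim: m => [|m IH]; first by rewrite partial_kernel0 /series/= big_nil.
  have [h1 h2 _] := prob0_even m ex.
  rewrite partial_kernelS /series/= big_nat_recr//= lerD//.
  by rewrite lerBlDr (le_trans h2)// lerDl prob0_ge0.
have large d : partial_kernel (N + d) x <= series harmonic N + 1 - N%:R / (N + d)%:R.
  elim: d => [|d IH].
    rewrite addn0 (le_trans (small N))// -addrA lerDl subr_ge0.
    by have [->|N0] := eqVneq N 0%N; rewrite ?mul0r// divff// pnatr_eq0.
  rewrite addnS partial_kernelS; have [_ _] := prob0_even (N + d) ex; rewrite NE => h.
  apply: (le_trans (lerD IH h)).
  rewrite -subr_ge0 -natr1.
  have [->|N0] := eqVneq N 0%N; first by rewrite !mul0r; lra.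
  have M0 : 0 < (N + d)%:R :> R by rewrite ltr0n; lia.
  have N1 : 0 < N%:R :> R by rewrite ltr0n; lia.
  move: (N + d)%:R M0 (series _ _) => M M0 H.
  rewrite [leRHS](_ : _ = N%:R / (M * (M + 1) ^+ 2)).
    by rewrite divr_ge0// mulr_ge0 ?sqr_ge0// ltW.
  by field; lra.
have [Nn|nN] := leqP N n.
  rewrite -(subnKC Nn) (le_trans (large _))//.
  by rewrite gerBl divr_ge0.
rewrite (le_trans (partial_kernel_even_nd ex (ltnW nN)))//.
by rewrite (le_trans (small N))// lerDl.
Qed.

Notation kernel := (potential_kernel R).

(** On even sites the partial sums are monotone and bounded. On odd sites they
are, up to [prob0 n x] which tends to zero, averages of those at even sites. *)
Lemma partial_kernel_cvg x : partial_kernel n x @[n --> \oo] --> kernel x.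
Proof.
suff [l hl] : exists l : R, partial_kernel n x @[n --> \oo] --> l.
  by have -> : kernel x = l by exact: (cvg_lim _ hl).
have even y : even_site y -> exists l : R, partial_kernel n y @[n --> \oo] --> l.
  move=> ey; exists (limn (partial_kernel ^~ y)).
  apply: nondecreasing_is_cvgn; first exact: partial_kernel_even_nd.
  by exists (series harmonic `|normsq y|%N + 1) => _ [n _ <-]; exact: partial_kernel_even_le.
have [/even//|ox] := boolP (even_site x).
pose f y := limn (partial_kernel ^~ y).
exists (avg f x - (x == 0)%:R + 0).
have -> : partial_kernel ^~ x = (fun n => avg (partial_kernel n) x - (x == 0)%:R + prob0 n x).
  by apply/funext => n; rewrite avg_partial_kernel; ring.
apply: cvgD (prob0_cvg0 x); apply: cvgB (cvg_cst _).
apply: cvg_avg => y /even_neighbours; rewrite ox => /even[l hl].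
by rewrite /f (cvg_lim _ hl).
Qed.

Lemma kernel0 : kernel 0 = 0.
Proof.
rewrite -(cvg_lim _ (@partial_kernel_cvg 0))//.
have -> : partial_kernel ^~ 0 = cst 0; last exact: lim_cst.
apply/funext; elim=> [|n IH]; first exact: partial_kernel0.
by rewrite partial_kernelS IH subrr addr0.
Qed.

Lemma avg_kernel x : avg kernel x = kernel x + (x == 0)%:R.
Proof.
have h1 : avg (partial_kernel n) x @[n --> \oo] --> avg kernel x.
  by apply: cvg_avg => y _; exact: partial_kernel_cvg.
have h2 : avg (partial_kernel n) x @[n --> \oo] --> kernel x + (x == 0)%:R - 0.
  under eq_fun do rewrite avg_partial_kernel.
  apply: cvgB (prob0_cvg0 x); apply: cvgD; first exact: partial_kernel_cvg.
  exact: cvg_cst.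
by rewrite -(cvg_lim _ h1)// (cvg_lim _ h2)// subr0.
Qed.

(** The term of index zero is one, and the others are nonnegative. *)
Lemma kernel_even_ge1 x : even_site x -> x != 0 -> 1 <= kernel x.
Proof.
move=> ex x0; have <- := cvg_lim _ (@partial_kernel_cvg x) => //.
apply: limr_ge; first by apply/cvg_ex; exists (kernel x); exact: partial_kernel_cvg.
near=> n.
have <- : partial_kernel 1 x = 1.
  by rewrite partial_kernelS partial_kernel0 !prob0_0 eqxx (negbTE x0) subr0 add0r.
by apply: partial_kernel_even_nd => //; near: n; exists 1%N.
Unshelve. all: by end_near. Qed.

Lemma kernel_even_le x : even_site x ->
  kernel x <= series harmonic `|normsq x|%N + 1.
Proof.
move=> ex; have <- := cvg_lim _ (@partial_kernel_cvg x) => //.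
apply: limr_le; first by apply/cvg_ex; exists (kernel x); exact: partial_kernel_cvg.
by near=> n; exact: partial_kernel_even_le.
Unshelve. all: by end_near. Qed.

Lemma kernel_even_ge0 x : even_site x -> 0 <= kernel x.
Proof.
move=> ex; have [->|x0] := eqVneq x 0; first by rewrite kernel0.
exact: le_trans (kernel_even_ge1 ex x0).
Qed.

Lemma kernel_gt0 x : x != 0 -> 0 < kernel x.
Proof.
have [ex x0|ox x0] := boolP (even_site x).
  exact: lt_le_trans (kernel_even_ge1 ex x0).
have := avg_kernel x; rewrite (negbTE x0) addr0 => <-.
have en y : y \in neighbours x -> even_site y by move/even_neighbours ->.
(* At most one of the four neighbours is the origin. *)
apply: (@lt_le_trans _ _ (avg (fun y => (y != 0)%:R) x)).
  case: x x0 {ox en} => a b x0; rewrite mulr_gt0 ?invr_gt0// -!natrD ltr0n /=.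
  by rewrite !xpair_eqE; lia.
apply: avg_le => y /en ey.
by have [->|y0] := eqVneq y 0; rewrite ?kernel0// kernel_even_ge1.
Qed.

End Kernel.

(** * Harmonic functions of sublinear growth *)

Section Liouville.
Context (R : realType).
Implicit Types (x y : Z2) (f u : Z2 -> R) (n : nat).

Definition harmonic_Z2 u := forall x, avg u x = u x.

Lemma sqr_avg_le f x : avg f x ^+ 2 <= avg (fun y => f y ^+ 2) x.
Proof.
rewrite /avg; move: (f _) (f _) (f _) (f _) => a b c d.
have := sqr_ge0 (a - b); have := sqr_ge0 (a - c); have := sqr_ge0 (a - d).
have := sqr_ge0 (b - c); have := sqr_ge0 (b - d); have := sqr_ge0 (c - d).
lra.
Qed.

Definition energy u x := avg (fun y => u y ^+ 2) x - u x ^+ 2.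

Lemma energyE u x : harmonic_Z2 u ->
  energy u x = avg (fun y => (u y - u x) ^+ 2) x.
Proof.
move=> /(_ x) h; rewrite /energy.
transitivity (avg (fun y => u y ^+ 2) x - 2 * u x * avg u x + u x ^+ 2).
  by rewrite h; ring.
by rewrite /avg; field.
Qed.

(** The increments [u (x + e) - u x] are harmonic in [x], so their squares are
subharmonic by [sqr_avg_le]. *)
Lemma energy_subharmonic u x : harmonic_Z2 u -> energy u x <= avg (energy u) x.
Proof.
move=> h.
have hd (e : Z2) :
    (u (x.1 + e.1, x.2 + e.2) - u x) ^+ 2 <=
    avg (fun y => (u (y.1 + e.1, y.2 + e.2) - u y) ^+ 2) x.
  apply: le_trans (sqr_avg_le _ x).
  rewrite le_eqVlt; apply/orP; left; apply/eqP; congr (_ ^+ 2).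
  rewrite -(h (x.1 + e.1, x.2 + e.2)) -(h x) /avg/= !(addrAC x.1 e.1) !(addrAC x.2 e.2).
  by field.
rewrite energyE//.
have -> : energy u = (fun z => avg (fun y => (u y - u z) ^+ 2) z).
  by apply/funext => z; rewrite energyE.
have h1 := hd (1, 0); have h2 := hd (-1, 0).
have h3 := hd (0, 1); have h4 := hd (0, -1).
rewrite /avg /= !addr0 in h1 h2 h3 h4 *.
lra.
Qed.

(** The induction compares second moments along the walk: averaging adds at
least [energy u] to [u^2] and exactly one to [normsq], so the inequality
between [n * energy u + u^2] and [al + be * (normsq + n)] propagates from [n]
to [n + 1]; dividing by [n] leaves [energy u <= be]. *)
Lemma energy_le u (al be : R) x : harmonic_Z2 u ->
  (forall y, u y ^+ 2 <= al + be * (normsq y)%:~R) -> energy u x <= be.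
Proof.
move=> h hu.
have main n y :
    n%:R * energy u y + u y ^+ 2 <= al + be * ((normsq y)%:~R + n%:R).
  elim: n y => [|n IH] y; first by rewrite mul0r add0r addr0.
  have e1 := energy_subharmonic y h.
  have e2 : avg (fun z => n%:R * energy u z + u z ^+ 2) y <=
            avg (fun z => al + be * ((normsq z)%:~R + n%:R)) y.
    by apply: avg_le => z _; exact: IH.
  have e3 : avg (fun z => n%:R * energy u z + u z ^+ 2) y =
            n%:R * avg (energy u) y + (energy u y + u y ^+ 2).
    by rewrite [energy u y + _]subrK /avg; field.
  have e4 : avg (fun z => al + be * ((normsq z)%:~R + n%:R)) y =
            al + be * ((normsq y)%:~R + 1 + n%:R).
    by rewrite -(avg_normsq R y) /avg; field.
  have e5 : 0 <= n%:R * (avg (energy u) y - energy u y) by rewrite mulr_ge0 ?subr_ge0.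
  rewrite e3 e4 in e2.
  rewrite -natr1.
  lra.
rewrite leNgt; apply/negP => lt.
have d0 : 0 < energy u x - be by rewrite subr_gt0.
pose c := al + be * (normsq x)%:~R.
have := main (Num.truncn (`|c| / (energy u x - be))).+1 x.
set n := _.+1.
have : `|c| / (energy u x - be) < n%:R by exact: truncnS_gt.
rewrite ltr_pdivrMr// => h1 h2.
have := sqr_ge0 (u x); have := ler_norm c.
rewrite /c in h1 *.
lra.
Qed.

Lemma energy0_cst u : harmonic_Z2 u -> (forall x, energy u x <= 0) ->
  forall x, u x = u 0.
Proof.
move=> h e0.
have e x y : y \in neighbours x -> u y = u x.
  move=> yx; have := e0 x; rewrite energyE// /avg.
  have := sqr_ge0 (u (x.1 + 1, x.2) - u x).
  have := sqr_ge0 (u (x.1 - 1, x.2) - u x).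
  have := sqr_ge0 (u (x.1, x.2 + 1) - u x).
  have := sqr_ge0 (u (x.1, x.2 - 1) - u x) => h4 h3 h2 h1 hs.
  apply/eqP; rewrite -subr_eq0 -sqrf_eq0 eq_le sqr_ge0 andbT.
  by move: yx; rewrite !inE => /or4P[] /eqP ->; lra.
case=> a b.
transitivity (u (0, b)).
  elim: a => [//|a <-|a <-].
    by apply: e; rewrite !inE; apply/or4P/Or41; rewrite xpair_eqE/=; lia.
  by apply: e; rewrite !inE; apply/or4P/Or42; rewrite xpair_eqE/=; lia.
elim: b => [//|b <-|b <-].
  by apply: e; rewrite !inE; apply/or4P/Or43; rewrite xpair_eqE/=; lia.
by apply: e; rewrite !inE; apply/or4P/Or44; rewrite xpair_eqE/=; lia.
Qed.

(** Any power above two would serve the purpose: it makes the square of the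
harmonic sum negligible with respect to [n]. The bounds of the first and second
powers feed the induction for the third. *)
Lemma harmonic_sum_cube n : (series harmonic n + 1) ^+ 3 <= 13 * (n%:R + 1) :> R.
Proof.
have : [/\ 1 <= series harmonic n + 1 :> R, series harmonic n + 1 <= n%:R + 1 :> R,
   (series harmonic n + 1) ^+ 2 <= 3 * (n%:R + 1) :> R
 & (series harmonic n + 1) ^+ 3 <= 13 * (n%:R + 1) :> R]; last by case.
elim: n => [|n].
  have -> : series harmonic 0 = 0 :> R by rewrite /series/= big_nil.
  by split; lra.
have -> : series harmonic n.+1 + 1 = (series harmonic n + 1) + n.+1%:R^-1 :> R.
  by rewrite /series/= big_nat_recr//= addrAC.
move: (series harmonic n + 1) => T [T1 Tn T2 T3].
rewrite -!(natr1 n).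
have n0 : 0 <= n%:R :> R by [].
set m := n%:R + 1 in Tn T2 T3 *.
have m1 : 1 <= m by rewrite /m; lra.
have i0 : 0 < m^-1 by rewrite invr_gt0; lra.
have i1 : m^-1 <= 1 by rewrite invf_le1//; lra.
have mi : m * m^-1 = 1 by rewrite divff//; lra.
have hT : T * m^-1 <= 1 by rewrite ler_pdivrMr ?mul1r//; lra.
have hT2 : T ^+ 2 * m^-1 <= 3 by rewrite ler_pdivrMr//; lra.
have hTi : T * m^-1 * m^-1 <= 1 by rewrite mulr_ile1 ?mulr_ge0//; lra.
have hi2 : m^-1 * m^-1 <= 1 by rewrite mulr_ile1//; lra.
have hi3 : m^-1 * m^-1 * m^-1 <= 1 by rewrite mulr_ile1 ?mulr_ge0//; lra.
move: (m^-1) i0 i1 mi hT hT2 hTi hi2 hi3 => r i0 i1 mi hT hT2 hTi hi2 hi3.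
split; lra.
Qed.

Notation kernel := (potential_kernel R).

(** Letting [K] grow makes the coefficient of [normsq x] as small as desired,
so [kernel x ^+ 2] is negligible with respect to [normsq x]. If [kernel x > K],
the square is at most the cube divided by [K]. *)
Lemma kernel_even_sqr (K : R) x : 0 < K -> even_site x ->
  kernel x ^+ 2 <= K ^+ 2 + 13 / K * ((normsq x)%:~R + 1).
Proof.
move=> K0 ex; have NE : (normsq x)%:~R = (`|normsq x|%N)%:R :> R.
  by rewrite natr_absz ger0_norm// normsq_ge0.
have := kernel_even_le R ex; have := kernel_even_ge0 R ex; rewrite NE.
have := harmonic_sum_cube `|normsq x|%N.
move: (`|normsq x|%N%:R : R) (ler0n R `|normsq x|%N) (series _ _ + 1) => N N0 T hT a0 aT.
have c0 : 0 <= 13 / K * (N + 1) by rewrite mulr_ge0 ?divr_ge0//; lra.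
have [aK|Ka] := lerP (kernel x) K.
  rewrite (@le_trans _ _ (K ^+ 2))//; last by rewrite lerDl.
  by rewrite ler_sqr ?nnegrE// ltW.
rewrite (@le_trans _ _ (13 / K * (N + 1)))//; last by rewrite lerDr sqr_ge0.
rewrite mulrAC ler_pdivlMr//; apply: le_trans hT.
apply: (@le_trans _ _ (kernel x ^+ 3)); last by rewrite lerXn2r// nnegrE; lra.
by rewrite (exprSr _ 2) ler_wpM2l ?sqr_ge0// ltW.
Qed.

(** On odd sites [u] is the average of its values at even sites, so the
quadratic bound extends to them with a larger constant term. *)
Lemma harmonic_kernel_bound u (C : R) : harmonic_Z2 u ->
  (forall x, `|u x| <= C * kernel x) -> forall x, u x = 0.
Proof.
move=> h hu.
have u0 : u 0 = 0 by apply/eqP; rewrite -normr_le0 (le_trans (hu 0))// kernel0 mulr0.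
move=> x; rewrite -u0; apply: energy0_cst => // {}x.
suff e (K : R) : 0 < K -> K * energy u x <= 13 * C ^+ 2.
  rewrite leNgt; apply/negP => E0.
  have K0 : 0 < (13 * C ^+ 2 + 1) / energy u x.
    by rewrite divr_gt0//; have := sqr_ge0 C; lra.
  by have := e _ K0; rewrite divfK ?gt_eqF//; lra.
move=> K0; rewrite mulrC -ler_pdivlMr//.
set be := _ / K; have be0 : 0 <= be by rewrite divr_ge0 ?(ltW K0)// mulr_ge0// sqr_ge0.
pose al := C ^+ 2 * K ^+ 2 + be.
have even y : even_site y -> u y ^+ 2 <= al + be * (normsq y)%:~R.
  move=> ey; rewrite -real_normK ?num_real//.
  apply: (@le_trans _ _ ((C * kernel y) ^+ 2)).
    by rewrite lerXn2r ?nnegrE// (le_trans _ (hu y)).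
  rewrite exprMn; apply: (le_trans (ler_wpM2l (sqr_ge0 C) (kernel_even_sqr K0 ey))).
  by rewrite /al /be; lra.
apply: (@energy_le _ (al + be)) => // y.
have [/even|oy] := boolP (even_site y); first lra.
rewrite -h; apply: (le_trans (sqr_avg_le _ _)).
apply: (@le_trans _ _ (avg (fun z => al + be * (normsq z)%:~R) y)).
  by apply: avg_le => z /even_neighbours; rewrite oy => /even.
have -> : avg (fun z => al + be * (normsq z)%:~R) y = al + be * avg (fun z => (normsq z)%:~R) y.
  by rewrite /avg; field.
by rewrite avg_normsq; lra.
Qed.

End Liouville.

(** * The conditioned walk *)

Lemma sum_pmap_sub (R : realType) (T : Type) (p : pred T) (sT : subType p)
    (F : sT -> R) (s : seq T) :
  \sum_(y <- pmap (insub : T -> option sT) s) F y =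
  \sum_(y <- s) if (insub y : option sT) is Some w then F w else 0.
Proof.
elim: s => [|y s IH]; first by rewrite !big_nil.
by rewrite [RHS]big_cons -IH /=; case: insub => [w|] /=; rewrite ?big_cons ?add0r.
Qed.

Definition punctured_neighbours (z : Z2_punctured) : seq Z2_punctured :=
  pmap insub (neighbours (val z)).

Lemma punctured_neighbours_uniq z : uniq (punctured_neighbours z).
Proof. exact/pmap_sub_uniq/neighbours_uniq. Qed.

Lemma mem_punctured_neighbours z w :
  (w \in punctured_neighbours z) = nearest_neighbour (val z) (val w).
Proof. by rewrite mem_pmap_sub mem_neighbours. Qed.

(** With [a] the potential kernel, [b] is the value that the constant must take:
it is the average of [a h] over the neighbours of the origin, where [a] itself
has average one. *)
Theorem theorem1p8 (R : realType) : Liouville_property (@conditioned_srw R).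
Proof.
move=> h [M [_ hM]] hh.
have {}hM x : `|h x| <= `|M| + 1.
  by apply: hM => //; rewrite (le_lt_trans (ler_norm M))// ltrDl.
pose a := potential_kernel R.
pose g (x : Z2) := if insub x is Some z then a x * h z else 0.
have g0 : g 0 = 0 by rewrite /g insubF.
have gE (z : Z2_punctured) : g (val z) = a (val z) * h z by rewrite /g valK.
(* Next to the origin the chain has one neighbour fewer than the planar walk;
   the average does not notice, as [g] vanishes there. *)
have avg_g (x : Z2) : x != 0 -> avg g x = g x.
  move=> x0; set z : Z2_punctured := Sub x x0.
  have az : a x != 0 by rewrite gt_eqF// kernel_gt0.
  have := hh z; rewrite (fsum_finite_range (@punctured_neighbours_uniq)); last first.
    by move=> v w; rewrite mem_punctured_neighbours /conditioned_srw => /negbTE ->.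
  have -> : g x = a x * h z by rewrite -[x]/(val z) gE.
  move=> ->; rewrite big_distrr /=.
  transitivity (\sum_(y <- punctured_neighbours z) 4^-1 * g (val y)); last first.
    apply: eq_big_seq => y; rewrite mem_punctured_neighbours /conditioned_srw => ->.
    by rewrite gE -/a /=; field.
  rewrite -big_distrr /= /punctured_neighbours sum_pmap_sub.
  transitivity (4^-1 * \sum_(y <- neighbours x) g y); first by rewrite sum_neighbours mulKf.
  congr (_ * _); apply: eq_bigr => y _.
  by case: insubP => [w _ <-//|/negbNE/eqP ->].
pose b := avg g 0.
pose u x := g x - b * a x.
have u0 : forall x, u x = 0.
  apply: (@harmonic_kernel_bound _ _ (`|M| + 1 + `|b|)).
    move=> x; transitivity (avg g x - b * avg a x); first by rewrite /u /avg; field.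
    have [->|x0] := eqVneq x 0.
      by rewrite avg_kernel eqxx kernel0 add0r mulr1 /u g0 /a kernel0 mulr0 subrr subr0.
    by rewrite avg_g// avg_kernel (negbTE x0) addr0.
  move=> x; have [->|x0] := eqVneq x 0.
    by rewrite /u g0 /a kernel0 !mulr0 subrr normr0.
  have a0 := kernel_gt0 R x0.
  rewrite /u -[x]/(val (Sub x x0 : Z2_punctured)) gE /= [b * _]mulrC -mulrBr normrM.
  rewrite gtr0_norm// mulrC ler_pM2r// (le_trans (ler_normB _ _))// lerD2r.
  exact: hM.
exists b => z; have := u0 (val z); rewrite /u gE mulrC -mulrBl => /eqP.
rewrite mulf_eq0 subr_eq0 [X in _ || X]gt_eqF ?orbF; first by move/eqP.
by apply: kernel_gt0; exact: (valP z).
Qed.
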